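(* Let $F$ be a graph, and let $n$ and $r$ be positive integers. Then \[ \mathrm{ex}(n,K_r,F)\le \mathrm{ex}_r(n,\textup{Berge-}F) \le \mathrm{ex}(n,K_r,F)+\mathrm{ex}(n,F) \] and \[ \mathrm{ex}(n,\textup{Berge-}F)=\max_{G} \left\{\sum_{i=0}^n \mathcal{N}(K_i,G) \right\} \leq \sum_{i=0}^n \mathrm{ex}(n,K_i,F), \] where the maximum is over all $n$-vertex $F$-free graphs $G$.
   Context: All graphs are finite and simple; hypergraphs are finite, without repeated hyperedges (hyperedges may have any size, including $0$ and $1$, unless uniformity is imposed). A hypergraph is $r$-uniform if all hyperedges have size $r$. A graph is $F$-free if it contains no copy of $F$ as a (not necessarily induced) subgraph. $\mathcal{N}(H,G)$ denotes the number of copies of $H$ in $G$ (subgraphs of $G$ isomorphic to $H$); $\mathcal N(K_i,G)$ is the number of $i$-element vertex sets that are cliques in $G$ (so $\mathcal N(K_0,G)=1$ and $\mathcal N(K_1,G)=|V(G)|$). $\mathrm{ex}(n,H,F)$ is the maximum of $\mathcal N(H,G)$ over $n$-vertex $F$-free graphs $G$, and $\mathrm{ex}(n,F)=\mathrm{ex}(n,K_2,F)$ is the maximum number of edges in an $n$-vertex $F$-free graph. A hypergraph $\mathcal{H}$ is a Berge-$F$ if (with $V(F)\subseteq V(\mathcal H)$, up to isomorphism) there is a bijection $f : E(F) \rightarrow E(\mathcal{H})$ such that $e \subseteq f(e)$ for every $e \in E(F)$. (Berge-$F$ denotes a class of hypergraphs.) $\mathrm{ex}(n,\textup{Berge-}F)$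 is the maximum number of hyperedges in an $n$-vertex hypergraph with no sub-hypergraph isomorphic to any Berge-$F$; $\mathrm{ex}_r(n,\textup{Berge-}F)$ is the same maximum restricted to $r$-uniform hypergraphs. The maxima are understood to be taken over nonempty families (automatic when $F$ has at least one edge). *)

(* Defs.v *)
From HB Require Import structures.
From mathcomp Require Import all_boot.

Set Implicit Arguments.
Unset Strict Implicit.
Unset Printing Implicit Defensive.

(* A hypergraph on the vertex type T is its set of hyperedges. *)
Definition hypergraph (T : finType) := {set {set T}}.

Definition uniform (T : finType) (r : nat) (H : hypergraph T) : bool :=
  [forall e in H, #|e| == r].

(* A simple graph is a 2-uniform hypergraph; isolated vertices are kept, since
   the vertex set is the whole of T. *)
Record graph (T : finType) : predArgType :=
  Graph { edges : hypergraph T; _ : uniform 2 edges }.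

HB.instance Definition _ (T : finType) := [isSub of graph T for @edges T].
HB.instance Definition _ (T : finType) := [Finite of graph T by <:].

Lemma complete_subproof (i : nat) :
  uniform 2 [set e : {set 'I_i} | #|e| == 2].
Proof. by apply/forall_inP => e; rewrite inE. Qed.

Definition complete (i : nat) : graph 'I_i := Graph (complete_subproof i).

(* The subgraphs (U, S) of G, with vertex set U and edge set S, that are
   isomorphic to H; the isomorphism g from H to (U, S) is given as a map from
   the vertices of H into T. *)
Definition copies (V T : finType) (H : graph V) (G : graph T) :
    {set {set T} * {set {set T}}} :=
  [set P : {set T} * {set {set T}} | (P.2 \subset edges G) &&
    [exists g : {ffun V -> T},
      [&& injectiveb g, g @: [set: V] == P.1 &
          [set g @: (e : {set V}) | e in edges H] == P.2]]].

Definition ncopies (V T : finType) (H : graph V) (G : graph T) : nat :=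
  #|copies H G|.

Definition free (V T : finType) (F : graph V) (G : graph T) : bool :=
  copies F G == set0.

(* The hypergraph with vertex set U and hyperedge set S is a Berge-F: g
   identifies V(F) with a subset of U, and f restricts to a bijection from
   E(F) onto S (its values outside E(F) are irrelevant). *)
Definition is_berge (V T : finType) (F : graph V)
    (U : {set T}) (S : {set {set T}}) : bool :=
  [exists g : {ffun V -> T}, exists f : {ffun {set V} -> {set T}},
    [&& injectiveb g, g @: [set: V] \subset U,
        dinjectiveb f (edges F), f @: edges F == S &
        [forall e in edges F, g @: e \subset f e]]].

(* No sub-hypergraph (U, S) of H is a Berge-F. *)
Definition berge_free (V T : finType) (F : graph V) (H : hypergraph T) : bool :=
  ~~ [exists U : {set T}, exists S : {set {set T}},
        [&& S \subset H, [forall e in S, e \subset U] & is_berge F U S]].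

(* The maxima below range over structures on the vertex set 'I_n, which loses
   nothing up to isomorphism. The families are all empty exactly when F has no
   edge and at most n vertices; \max is then 0. *)
Definition ex (V W : finType) (n : nat) (H : graph W) (F : graph V) : nat :=
  \max_(G : graph 'I_n | free F G) ncopies H G.

Definition ex_edge (V : finType) (n : nat) (F : graph V) : nat :=
  ex n (complete 2) F.

Definition ex_berge (V : finType) (n : nat) (F : graph V) : nat :=
  \max_(H : hypergraph 'I_n | berge_free F H) #|H|.

Definition ex_berge_uniform (V : finType) (r n : nat) (F : graph V) : nat :=
  \max_(H : hypergraph 'I_n | uniform r H && berge_free F H) #|H|.

(* Main.v *)
Require Import Defs.
From HB Require Import structures.
From mathcomp Require Import all_boot.

(** The last inequality bounds each summand by its own maximum.  The other claims
    come from comparing Berge-[F]-free hypergraphs with the cliques of [F]-free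
    graphs.

    From graphs to hypergraphs: any family [H] of cliques of an [F]-free graph
    [G] is Berge-[F]-free, because a Berge-[F] in [H] places each edge of [F] as
    a pair inside a clique of [G], hence on an edge of [G]
    ([berge_free_cliques]).  The family of [r]-cliques and the family of all
    cliques give the two lower bounds.

    From hypergraphs to graphs: given a Berge-[F]-free hypergraph [H], match
    pairs of vertices with distinct hyperedges of [H] that contain them.  The
    graph [G] of the matched pairs is [F]-free, since composing a copy of [F] in
    [G] with the matching gives a Berge-[F] in [H] ([free_of_matching]).  If the
    matching cannot be extended, every hyperedge left unmatched has all its pairs
    among the edges of [G], so it is a clique ([maximal_matching]).  Hence [H]
    has at most as many hyperedges as [G] has edges and cliques of the relevant
    sizes, which is the upper bound for uniform hypergraphs.

    Without uniformity this count could charge a 2-element clique twice, once as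
    a matched pair and once as an unmatched hyperedge.  Starting the matching by
    assigning every 2-element hyperedge to itself excludes this: matched
    hyperedges then correspond to edges of [G], the others are cliques of size
    different from 2, and altogether [H] injects into the cliques of [G]
    ([card_le_cliques]). *)

Set Implicit Arguments.
Unset Strict Implicit.
Unset Printing Implicit Defensive.

(** * Cliques and copies of complete graphs *)

Definition pairs (T : finType) (A : {set T}) : {set {set T}} :=
  [set e : {set T} | e \subset A & #|e| == 2].

Definition cliques (T : finType) (G : graph T) : {set {set T}} :=
  [set A : {set T} | pairs A \subset edges G].

Definition cliques_of_size (T : finType) (i : nat) (G : graph T) :=
  [set A in cliques G | #|A| == i].

Lemma card_edge (T : finType) (G : graph T) (e : {set T}) :
  e \in edges G -> #|e| = 2.
Proof. by case: G => E /= /forall_inP unifE /unifE /eqP. Qed.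

Lemma pairs_card2 (T : finType) (e : {set T}) : #|e| = 2 -> pairs e = [set e].
Proof.
move=> e2; apply/setP => d; rewrite !inE.
apply/andP/eqP => [[sub_de /eqP d2]|->]; last by rewrite subxx e2.
by apply/eqP; rewrite eqEcard sub_de d2 e2.
Qed.

Lemma edges_sub_cliques (T : finType) (G : graph T) : edges G \subset cliques G.
Proof.
apply/subsetP => e Ge.
by rewrite inE (pairs_card2 (card_edge Ge)) sub1set.
Qed.

Lemma cliques2 (T : finType) (G : graph T) : cliques_of_size 2 G = edges G.
Proof.
apply/setP => e; rewrite inE; apply/andP/idP => [[]|Ge].
  by rewrite inE => + /eqP e2; rewrite pairs_card2 // sub1set.
by rewrite (subsetP (edges_sub_cliques G)) ?(card_edge Ge).
Qed.

Lemma imset_pairs (V T : finType) (g : V -> T) (A : {set V}) :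
  injective g -> [set g @: (e : {set V}) | e in pairs A] = pairs (g @: A).
Proof.
move=> inj_g; apply/setP => d; apply/imsetP/idP => [[e + ->]|].
  rewrite !inE card_imset // => /andP[sub_eA ->].
  by rewrite imsetS.
rewrite inE => /andP[/subsetP sub_dA d2].
have defd : d = g @: (g @^-1: d).
  apply/setP => y; apply/idP/imsetP => [dy|[x + ->]]; last by rewrite inE.
  by have /imsetP[x _ y_gx] := sub_dA y dy; exists x; rewrite // inE -y_gx.
exists (g @^-1: d) => //; rewrite inE -(card_imset _ inj_g) -defd d2 andbT.
by apply/subsetP => x /[!inE] /sub_dA /imsetP[z Az /inj_g ->].
Qed.

Lemma edges_complete (i : nat) : edges (complete i) = pairs [set: 'I_i].
Proof. by apply/setP => e; rewrite !inE subsetT. Qed.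

Lemma card_imset_inj (T : finType) (A : {set T}) (i : nat) :
  #|A| = i -> exists2 g : {ffun 'I_i -> T}, injective g & g @: [set: 'I_i] = A.
Proof.
move=> <-; exists [ffun k => enum_val k].
  by move=> j k; rewrite !ffunE; apply: enum_val_inj.
apply/setP => x; apply/imsetP/idP => [[k _ ->]|Ax].
  by rewrite ffunE enum_valP.
by exists (enum_rank_in Ax x); rewrite ?inE // ffunE enum_rankK_in.
Qed.

(** A copy of a complete graph is determined by its vertex set, its edges being
    all pairs of vertices. *)
Lemma ncopies_complete (T : finType) (i : nat) (G : graph T) :
  ncopies (complete i) G = #|cliques_of_size i G|.
Proof.
pose with_pairs (A : {set T}) := (A, pairs A).
have inj_wp : injective with_pairs by move=> A B [].
rewrite -(card_imset _ inj_wp); apply: eq_card => -[U S].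
rewrite inE edges_complete /=; apply/andP/imsetP.
  case=> sub_SG /existsP[g /and3P[/injectiveP inj_g /eqP defU /eqP defS]].
  rewrite imset_pairs // defU in defS.
  exists U; last by rewrite /with_pairs defS.
  by rewrite !inE defS sub_SG -defU card_imset // cardsT card_ord eqxx.
case=> A /[!inE] /andP[cliqueA /eqP /card_imset_inj[g inj_g defA]] [-> ->].
split=> //; apply/existsP; exists g.
by rewrite imset_pairs // defA !eqxx !andbT; apply/injectiveP.
Qed.

Lemma sum_ncopies_complete (n : nat) (G : graph 'I_n) :
  \sum_(0 <= i < n.+1) ncopies (complete i) G = #|cliques G|.
Proof.
have size_lt (A : {set 'I_n}) : #|A| < n.+1.
  by rewrite ltnS (leq_trans (max_card _)) ?card_ord.
rewrite big_mkord -sum1_card.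
rewrite (partition_big (fun A => Ordinal (size_lt A)) predT) //=.
apply: eq_bigr => i _; rewrite ncopies_complete -sum1_card.
by apply: eq_bigl => A; rewrite inE.
Qed.

(** * Copies of F and Berge copies of F, as maps *)

Lemma freePn (V T : finType) (F : graph V) (G : graph T) :
  reflect (exists2 g : {ffun V -> T}, injective g &
             forall e, e \in edges F -> g @: e \in edges G)
          (~~ free F G).
Proof.
apply: (iffP (set0Pn _)) => [[P]|[g inj_g edge_g]].
  rewrite inE => /andP[/subsetP sub_PG /existsP[g]].
  case/and3P=> /injectiveP inj_g _ /eqP defP.
  by exists g => // e Fe; rewrite sub_PG // -defP imset_f.
exists (g @: [set: V], [set g @: (e : {set V}) | e in edges F]).
rewrite inE /=; apply/andP; split.
  by apply/subsetP => _ /imsetP[e Fe ->]; apply: edge_g.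
by apply/existsP; exists g; rewrite !eqxx !andbT; apply/injectiveP.
Qed.

Lemma berge_freePn (V T : finType) (F : graph V) (H : hypergraph T) :
  reflect (exists g : {ffun V -> T}, exists f : {ffun {set V} -> {set T}},
             [/\ injective g, {in edges F &, injective f} &
                 forall e, e \in edges F -> f e \in H /\ g @: e \subset f e])
          (~~ berge_free F H).
Proof.
rewrite negbK; apply: (iffP existsP) => [[U /existsP[S]]|[g [f [inj_g inj_f fP]]]].
  case/and3P=> /subsetP sub_SH _ /existsP[g /existsP[f]].
  case/and5P=> /injectiveP inj_g _ /dinjectiveP inj_f /eqP defS /forall_inP sub_gf.
  exists g, f; split=> // e Fe; split; last exact: sub_gf.
  by rewrite sub_SH // -defS imset_f.
(* The vertex set of a sub-hypergraph can be enlarged freely, so take all of T. *)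
exists setT; apply/existsP; exists (f @: edges F); apply/and3P; split.
- by apply/subsetP => _ /imsetP[e /fP[Hfe _] ->].
- by apply/forall_inP => e _; apply: subsetT.
apply/existsP; exists g; apply/existsP; exists f.
rewrite subsetT eqxx /=; apply/and3P; split; first exact/injectiveP.
  exact/dinjectiveP.
by apply/forall_inP => e /fP[].
Qed.

(** * From F-free graphs to Berge-F-free hypergraphs *)

(** A pair inside a clique is an edge, so the core of a Berge-[F] made of cliques
    is a copy of [F]. *)
Lemma berge_free_cliques (V T : finType) (F : graph V) (G : graph T)
    (H : hypergraph T) :
  free F G -> H \subset cliques G -> berge_free F H.
Proof.
move=> freeG /subsetP sub_HG; apply: contraLR freeG.
case/berge_freePn=> g [f [inj_g _ fP]]; apply/freePn; exists g => // e Fe.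
have [/sub_HG /[!inE] /subsetP clique_fe sub_gf] := fP e Fe.
by apply: clique_fe; rewrite inE sub_gf card_imset // (card_edge Fe).
Qed.

(** * From Berge-F-free hypergraphs to F-free graphs *)

Definition matching (T : finType) (H : hypergraph T) (G : graph T)
    (m : {ffun {set T} -> {set T}}) : bool :=
  dinjectiveb m (edges G) &&
  [forall e in edges G, (m e \in H) && (e \subset m e)].

(** The requirement that prevents counting a 2-element set both as a matched pair
    and as an unmatched hyperedge. *)
Definition fixes_pairs (T : finType) (H : hypergraph T) (G : graph T)
    (m : {ffun {set T} -> {set T}}) : bool :=
  [forall e in H, (#|e| == 2) ==> (e \in edges G) && (m e == e)].

Lemma matchingP (T : finType) (H : hypergraph T) (G : graph T)
    (m : {ffun {set T} -> {set T}}) :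
  reflect ({in edges G &, injective m} /\
           forall e, e \in edges G -> m e \in H /\ e \subset m e)
          (matching H G m).
Proof.
apply: (iffP andP) => [[/dinjectiveP inj_m /forall_inP mP]|[inj_m mP]].
  by split=> // e /mP /andP.
by split; [apply/dinjectiveP | apply/forall_inP => e /mP [-> ->]].
Qed.

(** The hyperedges matched with the edges of a copy of [F] form a Berge-[F]. *)
Lemma free_of_matching (V T : finType) (F : graph V) (H : hypergraph T)
    (G : graph T) (m : {ffun {set T} -> {set T}}) :
  matching H G m -> berge_free F H -> free F G.
Proof.
case/matchingP=> inj_m mP; apply: contraLR => /freePn[g inj_g edge_g].
apply/berge_freePn; exists g, [ffun e : {set V} => m (g @: e)].
split=> // [d e Fd Fe|e Fe]; rewrite !ffunE; last exact/mP/edge_g.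
by move/(inj_m _ _ (edge_g d Fd) (edge_g e Fe)); apply: imset_inj.
Qed.

Lemma add_edge_subproof (T : finType) (G : graph T) (e : {set T}) :
  #|e| = 2 -> uniform 2 (e |: edges G).
Proof.
move=> e2; apply/forall_inP => d /setU1P[->|Gd]; first exact/eqP.
exact/eqP/(card_edge Gd).
Qed.

Definition add_edge (T : finType) (G : graph T) (e : {set T}) (e2 : #|e| = 2) :
  graph T := Graph (add_edge_subproof G e2).

Lemma matching_add_edge (T : finType) (H : hypergraph T) (G : graph T)
    (m : {ffun {set T} -> {set T}}) (e h : {set T}) (e2 : #|e| = 2) :
    e \notin edges G -> h \in H -> h \notin m @: edges G -> e \subset h ->
    matching H G m -> fixes_pairs H G m ->
  let m' := [ffun d => if d == e then h else m d] in
  matching H (add_edge G e2) m' && fixes_pairs H (add_edge G e2) m'.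
Proof.
move=> notGe Hh free_h sub_eh /matchingP[inj_m mP] /forall_inP fix_m /=.
have neq_e d : d \in edges G -> (d == e) = false.
  by move=> Gd; apply: contraNF notGe => /eqP <-.
have neq_h d : d \in edges G -> m d <> h.
  by move=> Gd mdh; rewrite -mdh imset_f in free_h.
apply/andP; split.
  apply/matchingP; split=> [c d|d] /=.
    case/setU1P=> [->|Gc] /setU1P[->|Gd] //; rewrite !ffunE ?eqxx.
    - by rewrite neq_e // => /esym/(neq_h d Gd).
    - by rewrite neq_e // => /(neq_h c Gc).
    - by rewrite !neq_e //; apply: inj_m.
  case/setU1P=> [->|Gd]; first by rewrite ffunE eqxx.
  by rewrite ffunE neq_e //; apply: mP.
apply/forall_inP => d Hd; apply/implyP => d2.
have /andP[Gd md] := implyP (fix_m d Hd) d2.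
by rewrite ffunE neq_e // md /= in_setU1 Gd orbT.
Qed.

Lemma pairs_of_subproof (T : finType) (H : hypergraph T) :
  uniform 2 [set e in H | #|e| == 2].
Proof. by apply/forall_inP => e; rewrite inE => /andP[]. Qed.

(** An unmatched hyperedge containing a pair that is not an edge would extend a
    matching with the largest number of edges; the matching sending the 2-element
    hyperedges to themselves is there to start from. *)
Lemma maximal_matching (T : finType) (H : hypergraph T) :
  exists G : graph T, exists m : {ffun {set T} -> {set T}},
    [/\ matching H G m, fixes_pairs H G m &
        H :\: m @: edges G \subset cliques G].
Proof.
pose valid (p : graph T * {ffun {set T} -> {set T}}) :=
  matching H p.1 p.2 && fixes_pairs H p.1 p.2.
pose start := (Graph (pairs_of_subproof H), [ffun e : {set T} => e]).
have valid_start : valid start.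
  apply/andP; split; last first.
    apply/forall_inP => e He; apply/implyP => e2.
    by rewrite ffunE inE He e2 eqxx.
  apply/matchingP; split=> [d e _ _|e]; rewrite !ffunE //=.
  by rewrite inE => /andP[].
case: (arg_maxnP (fun p => #|edges p.1|) valid_start) => -[G m].
case/andP=> /= match_m fix_m max_m; exists G, m; split=> //.
apply/subsetP => h /setDP[Hh free_h].
rewrite inE; apply/subsetP => e; rewrite inE => /andP[sub_eh /eqP e2].
apply: contraT => notGe.
have valid_ext := matching_add_edge e2 notGe Hh free_h sub_eh match_m fix_m.
by have := max_m (_, _) valid_ext; rewrite /= cardsU1 notGe ltnn.
Qed.

Lemma card_matched (T : finType) (H : hypergraph T) (G : graph T)
    (m : {ffun {set T} -> {set T}}) :
  matching H G m -> #|H| = #|edges G| + #|H :\: m @: edges G|.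
Proof.
case/matchingP=> inj_m mP; rewrite -(card_in_imset inj_m).
rewrite -(cardsID (m @: edges G) H) (setIidPr _) //.
by apply/subsetP => _ /imsetP[e /mP[Hme _] ->].
Qed.

Lemma card_le_edges_cliques (V T : finType) (F : graph V) (r : nat)
    (H : hypergraph T) :
    uniform r H -> berge_free F H ->
  exists2 G : graph T, free F G &
    #|H| <= #|cliques_of_size r G| + #|edges G|.
Proof.
move=> /forall_inP unifH bfH; have [G [m [match_m _ unmatched]]] := maximal_matching H.
exists G; first exact: free_of_matching match_m bfH.
rewrite (card_matched match_m) addnC leq_add2r subset_leq_card //.
apply/subsetP => h h_un; rewrite inE (subsetP unmatched) //.
by apply: unifH; case/setDP: h_un.
Qed.

Lemma card_le_cliques (V T : finType) (F : graph V) (H : hypergraph T) :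
  berge_free F H -> exists2 G : graph T, free F G & #|H| <= #|cliques G|.
Proof.
move=> bfH; have [G [m [match_m fix_m unmatched]]] := maximal_matching H.
exists G; first exact: free_of_matching match_m bfH.
(* An edge of G that is a hyperedge is matched with itself, hence not unmatched. *)
have disj : [disjoint edges G & H :\: m @: edges G].
  apply/pred0Pn => -[e /andP[/= Ge /setDP[He /imsetP[]]]].
  have /implyP/(_ _)/andP[|_ /eqP me] := forall_inP fix_m e He.
    by rewrite (card_edge Ge).
  by exists e.
rewrite (card_matched match_m) -cardsUI (disjoint_setI0 disj) cards0 addn0.
by rewrite subset_leq_card // subUset edges_sub_cliques.
Qed.

(** * The bounds on the extremal numbers *)

Theorem proposition18 (V : finType) (F : graph V) (n r : nat)
    (hn : 0 < n) (hr : 0 < r) :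
  [/\ ex n (complete r) F <= ex_berge_uniform r n F,
      ex_berge_uniform r n F <= ex n (complete r) F + ex_edge n F,
      ex_berge n F =
        \max_(G : graph 'I_n | free F G)
          \sum_(0 <= i < n.+1) ncopies (complete i) G &
      \max_(G : graph 'I_n | free F G)
          \sum_(0 <= i < n.+1) ncopies (complete i) G
        <= \sum_(0 <= i < n.+1) ex n (complete i) F].
Proof.
have le_ex i (G : graph 'I_n) : free F G -> ncopies (complete i) G <= ex n (complete i) F.
  by move=> freeG; apply: leq_bigmax_cond.
split.
- apply/bigmax_leqP => G freeG; rewrite ncopies_complete.
  apply: (leq_bigmax_cond (cliques_of_size r G : hypergraph 'I_n)).
  apply/andP; split; first by apply/forall_inP => A; rewrite inE => /andP[].
  by apply: berge_free_cliques freeG _; apply/subsetP => A; rewrite inE => /andP[].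
- apply/bigmax_leqP => H /andP[unifH bfH].
  have [G freeG /leq_trans->//] := card_le_edges_cliques unifH bfH.
  by rewrite -cliques2 -!ncopies_complete leq_add ?le_ex.
- apply/eqP; rewrite eqn_leq; apply/andP; split; apply/bigmax_leqP.
    move=> H bfH; have [G freeG /leq_trans->//] := card_le_cliques bfH.
    by rewrite -sum_ncopies_complete; apply: leq_bigmax_cond.
  move=> G freeG; rewrite sum_ncopies_complete.
  by apply: leq_bigmax_cond; apply: berge_free_cliques freeG _.
- apply/bigmax_leqP => G freeG.
  by apply: leq_sum => i _; apply: le_ex.
Qed.
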